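(* Let $(G,d)$ be a strongly connected graph with absorption on $n\ge 2$ vertices, with graph Laplacian $L$, and let $L^d$ be the absorption inverse of $L$ with respect to $d$. Let $Y\in\mathbb{R}^{n\times n}$ be any $\{1\}$-inverse of $L$, i.e. any matrix with $LYL=L$. Then $$L^d=(I-UD)\,Y\,(I-DU).$$ In particular, one can take $Y=L^\dagger$ (the Moore-Penrose pseudoinverse of $L$), $Y=L^{\#}$ (the group inverse of $L$), or $Y=Z$, where $Z=(L+\pi w^T)^{-1}$ is the fundamental matrix of the regular Markov process generated by $L$.
   Context: $G$ is a strongly connected, weighted, directed graph on $V=\{1,\dots,n\}$ with weighted adjacency matrix $A=(a_{ij})\in\mathbb{R}^{n\times n}$, $a_{ij}\ge 0$, where $a_{ij}$ is the weight of the edge from $j$ to $i$ (with $a_{ij}>0$ exactly when that edge is present). The outdegrees are $w_i=\sum_{j=1}^n a_{ji}$, $w=(w_1,\dots,w_n)^T$, $W=\mathrm{diag}\{w\}$, and the graph Laplacian is $L=W-A$, so $\mathbf{1}^TL=0$, where $\mathbf{1}$ is the column vector of ones. The vector $d=(d_1,\dots,d_n)^T$ has all $d_i>0$ (absorption rates), and $D=\mathrm{diag}\{d\}$. The kernel of $L$ is one-dimensional; $u$ denotes its unique spanning vector with positive entries and $\sum_i u_i=1$. Put $\bar d=d^Tu$ and $U=u\mathbf{1}^T/\bar d$. Let $N_{1,0}=\{x\in\mathbb{R}^n: Dx\in\mathrm{range}\,L\}$ and $R_{1,0}=\{Dx: x\in\ker L\}$. The absorption inverse $L^d$ of $L$ with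 respect to $d$ is the (unique) matrix $X\in\mathbb{R}^{n\times n}$ with $XLy=y$ for all $y\in N_{1,0}$ and $Xy=0$ for all $y\in R_{1,0}$. The group inverse $L^{\#}$ is the unique matrix with $LL^{\#}L=L$, $L^{\#}LL^{\#}=L^{\#}$, $LL^{\#}=L^{\#}L$. Let $P=AW^{-1}$ and let $\pi$ be the stationary distribution: $P\pi=\pi$, $\mathbf{1}^T\pi=1$, $\pi$ with positive entries. The fundamental matrix of the regular Markov process generated by $L$ is $Z=(L+\pi w^T)^{-1}=W^{-1}(I-P+\pi\mathbf{1}^T)^{-1}$. *)

(* Defs.v *)
From HB Require Import structures.
From mathcomp Require Import all_boot all_order all_algebra.
From mathcomp Require Import boolp classical_sets reals.

Set Implicit Arguments.
Unset Strict Implicit.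
Unset Printing Implicit Defensive.

Import Order.TTheory GRing.Theory Num.Theory.
Local Open Scope classical_set_scope.
Local Open Scope ring_scope.

(* Vectors are columns.  Objects introduced as "the unique object such that ..."
   are encoded as [xget 0 S] with S the set of solutions: an element of S, or the
   default 0 if S is empty. *)

(* A i j is the weight of the edge from j to i, present exactly when it is
   positive. *)
Definition edge (R : realType) (n : nat) (A : 'M[R]_n) : rel 'I_n :=
  fun j i => 0 < A i j.

Definition strongly_connected (R : realType) (n : nat) (A : 'M[R]_n) : Prop :=
  forall i j : 'I_n, connect (edge A) i j.

Definition ones (R : realType) (n : nat) : 'cV[R]_n := const_mx 1.
Arguments ones {R n}.

Definition diagc (R : realType) (n : nat) (v : 'cV[R]_n) : 'M[R]_n :=
  diag_mx v^T.

Definition outdegree (R : realType) (n : nat) (A : 'M[R]_n) : 'cV[R]_n :=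
  \col_i \sum_j A j i.

Definition laplacian (R : realType) (n : nat) (A : 'M[R]_n) : 'M[R]_n :=
  diagc (outdegree A) - A.

Definition mxker (R : realType) (n : nat) (M : 'M[R]_n) : set 'cV[R]_n :=
  [set x | M *m x = 0].

Definition mxrange (R : realType) (n : nat) (M : 'M[R]_n) : set 'cV[R]_n :=
  range (fun x : 'cV[R]_n => M *m x).

Definition kernel_vector (R : realType) (n : nat) (L : 'M[R]_n) : 'cV[R]_n :=
  xget 0 [set u | [/\ mxker L = range (fun c : R => c *: u),
                      forall i, 0 < u i 0
                    & \sum_i u i 0 = 1]].

(* u 1^T / (d^T u), with u the normalised kernel vector of L *)
Definition absorption_U (R : realType) (n : nat) (L : 'M[R]_n) (d : 'cV[R]_n) :
    'M[R]_n :=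
  let u := kernel_vector L in
  ((d^T *m u) 0 0)^-1 *: (u *m ones^T).

Definition N10 (R : realType) (n : nat) (L : 'M[R]_n) (d : 'cV[R]_n) :
    set 'cV[R]_n :=
  [set x | mxrange L (diagc d *m x)].

Definition R10 (R : realType) (n : nat) (L : 'M[R]_n) (d : 'cV[R]_n) :
    set 'cV[R]_n :=
  [set diagc d *m x | x in mxker L].

Definition absorption_inverse (R : realType) (n : nat) (L : 'M[R]_n)
    (d : 'cV[R]_n) : 'M[R]_n :=
  xget 0 [set X | (forall y, N10 L d y -> X *m L *m y = y) /\
                  (forall y, R10 L d y -> X *m y = 0)].

(* MathComp's [pinvmx] is only some generalised inverse, so the Moore-Penrose
   inverse is specified by the four Penrose equations. *)
Definition moore_penrose (R : realType) (n : nat) (M : 'M[R]_n) : 'M[R]_n :=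
  xget 0 [set Y | [/\ M *m Y *m M = M, Y *m M *m Y = Y,
                      (M *m Y)^T = M *m Y & (Y *m M)^T = Y *m M]].

Definition group_inverse (R : realType) (n : nat) (M : 'M[R]_n) : 'M[R]_n :=
  xget 0 [set Y | [/\ M *m Y *m M = M, Y *m M *m Y = Y & M *m Y = Y *m M]].

Definition transition (R : realType) (n : nat) (A : 'M[R]_n) : 'M[R]_n :=
  A *m invmx (diagc (outdegree A)).

Definition stationary (R : realType) (n : nat) (A : 'M[R]_n) : 'cV[R]_n :=
  xget 0 [set p | [/\ transition A *m p = p, \sum_i p i 0 = 1
                    & forall i, 0 < p i 0]].

(* The inverse of this matrix is the fundamental matrix; [invmx] is the
   identity map on singular matrices, so invertibility has to be claimed
   separately. *)
Definition fundamental_base (R : realType) (n : nat) (A : 'M[R]_n) : 'M[R]_n :=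
  laplacian A + stationary A *m (outdegree A)^T.

Definition fundamental (R : realType) (n : nat) (A : 'M[R]_n) : 'M[R]_n :=
  invmx (fundamental_base A).

(* Main.v *)
(* The Laplacian L has a kernel spanned by a positive vector u: if L v = 0 then
   L |v| = 0, and by strong connectivity a kernel vector with a zero entry
   vanishes.  Hence the left kernel of L is spanned by 1^T.  For a {1}-inverse G
   and q^T u = 1 = 1^T p, the matrix Y = (I - u q^T) G (I - p 1^T) then satisfies
   L Y = I - p 1^T, Y L = I - u q^T and Y p = 0.  Taking q = d / (d^T u) and
   p = D u / (d^T u), the last two equations characterise the absorption inverse;
   other choices of p and q give the Moore-Penrose and group inverses.  The
   fundamental matrix Z is a {1}-inverse because Z maps pi into the kernel of L. *)
Require Import Defs.
From HB Require Import structures.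
From mathcomp Require Import all_boot all_order all_algebra.
From mathcomp Require Import boolp classical_sets reals.

Set Implicit Arguments.
Unset Strict Implicit.
Unset Printing Implicit Defensive.

Import Order.TTheory GRing.Theory Num.Theory.
Local Open Scope ring_scope.

(** * Sums and pairings written with [ones] and [diagc] *)

Lemma ones_mulE (R : realType) (n : nat) (v : 'cV[R]_n) :
  (ones^T *m v) 0 0 = \sum_i v i 0.
Proof. by rewrite mxE; apply: eq_bigr => i _; rewrite !mxE mul1r. Qed.

Lemma ones_diagc (R : realType) (n : nat) (d : 'cV[R]_n) :
  ones^T *m diagc d = d^T.
Proof. by apply/rowP => j; rewrite mul_mx_diag !mxE mul1r. Qed.

Lemma diagc_mulE (R : realType) (n : nat) (d v : 'cV[R]_n) i :
  (diagc d *m v) i 0 = d i 0 * v i 0.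
Proof. by rewrite mul_diag_mx !mxE. Qed.

Lemma dot_gt0 (R : realType) (n : nat) (hn : (0 < n)%N) (d u : 'cV[R]_n) :
  (forall i, 0 < d i 0) -> (forall i, 0 < u i 0) -> 0 < (d^T *m u) 0 0.
Proof.
move=> d0 u0; rewrite mxE (bigD1 (Ordinal hn)) //= ltr_wpDr //; last first.
  by rewrite mxE mulr_gt0.
by apply: sumr_ge0 => i _; rewrite mxE mulr_ge0 // ltW.
Qed.

Lemma ones_laplacian (R : realType) (n : nat) (A : 'M[R]_n) :
  ones^T *m laplacian A = 0.
Proof.
rewrite /laplacian mulmxBr ones_diagc; apply/rowP => j; rewrite !mxE.
apply/eqP; rewrite subr_eq0; apply/eqP; apply: eq_bigr => i _.
by rewrite !mxE mul1r.
Qed.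

(** * The kernel of the Laplacian *)

Lemma laplacian_kerP (R : realType) (n : nat) (A : 'M[R]_n) (v : 'cV[R]_n) :
  laplacian A *m v = 0 <->
  forall i, outdegree A i 0 * v i 0 = \sum_j A i j * v j 0.
Proof.
rewrite /laplacian mulmxBl; split=> [/subr0_eq H i | H].
  by rewrite -diagc_mulE H mxE.
by apply/eqP; rewrite subr_eq0; apply/eqP/colP => i; rewrite diagc_mulE H mxE.
Qed.

(* The inequalities w_i |v_i| <= sum_j a_ij |v_j| have the same sum on both
   sides, so they are all equalities. *)
Lemma laplacian_ker_abs (R : realType) (n : nat) (A : 'M[R]_n)
    (hA : forall i j, 0 <= A i j) (v : 'cV[R]_n) :
  laplacian A *m v = 0 -> laplacian A *m map_mx Num.norm v = 0.
Proof.
move=> /laplacian_kerP Lv; apply/laplacian_kerP => i0.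
have w0 i : 0 <= outdegree A i 0 by rewrite mxE sumr_ge0.
pose F i := \sum_j A i j * `|v j 0| - outdegree A i 0 * `|v i 0|.
have F0 i : 0 <= F i.
  rewrite subr_ge0 -[X in X * _]ger0_norm // -normrM Lv.
  rewrite (le_trans (ler_norm_sum _ _ _)) //.
  by apply: ler_sum => j _; rewrite normrM ger0_norm.
have sF : \sum_i F i = 0.
  rewrite sumrB exchange_big /= -sumrB big1 // => j _.
  by rewrite mxE big_distrl /= subrr.
have /eqP := sF; rewrite psumr_eq0 // => /allP/(_ i0).
rewrite mem_index_enum => /(_ isT)/eqP/subr0_eq Fi.
by rewrite [map_mx _ _ _ _]mxE -Fi; apply: eq_bigr => j _; rewrite mxE.
Qed.

(** After passing to [|v|], the kernel equation at a vertex where [v] vanishes is a zero sum of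
    nonnegative terms, so [v] vanishes at all in-neighbours. Zeros thus spread backwards along a
    path from [j] to [i]. *)
Lemma laplacian_ker_eq0 (R : realType) (n : nat) (A : 'M[R]_n)
    (hA : forall i j, 0 <= A i j) (hG : strongly_connected A)
    (v : 'cV[R]_n) i :
  laplacian A *m v = 0 -> v i 0 = 0 -> v = 0.
Proof.
move=> /(laplacian_ker_abs hA)/laplacian_kerP Lv vi.
apply/colP => j; rewrite [RHS]mxE.
have step k l : edge A k l -> v l 0 = 0 -> v k 0 = 0.
  rewrite /edge => Alk vl; have /esym/eqP := Lv l.
  rewrite [X in _ * X]mxE vl normr0 mulr0 psumr_eq0; last first.
    by move=> m _; rewrite mxE mulr_ge0.
  move=> /allP/(_ k); rewrite mem_index_enum => /(_ isT) /=.
  by rewrite mxE mulf_eq0 (gt_eqF Alk) normr_eq0 => /eqP.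
have /connectP[p] := hG j i.
elim: p j => [|k p IHp] j /=; first by move=> _ <-.
by move=> /andP[ejk pp] iE; apply: (step _ k ejk); exact: IHp.
Qed.

(** The left null vector [ones^T] makes the determinant vanish, which gives a nonzero right null
    vector; its entrywise absolute value, normalised, is the witness. *)
Lemma laplacian_ker_pos (R : realType) (n : nat) (hn : (0 < n)%N)
    (A : 'M[R]_n) (hA : forall i j, 0 <= A i j) (hG : strongly_connected A) :
  exists u : 'cV[R]_n,
    [/\ laplacian A *m u = 0, forall i, 0 < u i 0 & \sum_i u i 0 = 1].
Proof.
have /eqP : \det (laplacian A)^T = 0.
  rewrite det_tr; apply/eqP/det0P; exists ones^T; last exact: ones_laplacian.
  apply/eqP => /rowP/(_ (Ordinal hn))/eqP.
  by rewrite !mxE oner_eq0.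
move=> /eqP/eqP/det0P[r r0 rL].
pose v : 'cV[R]_n := map_mx Num.norm r^T.
have Lr : laplacian A *m r^T = 0 by rewrite -[LHS]trmxK trmx_mul trmxK rL trmx0.
have v0 i : 0 < v i 0.
  rewrite mxE normr_gt0; apply/eqP => ri; move: r0.
  by rewrite -trmx_eq0 (laplacian_ker_eq0 hA hG Lr ri) eqxx.
have s0 : 0 < \sum_i v i 0.
  rewrite (bigD1 (Ordinal hn)) //= ltr_wpDr //.
  by apply: sumr_ge0 => i _; rewrite ltW.
exists ((\sum_i v i 0)^-1 *: v); split.
- by rewrite -scalemxAr laplacian_ker_abs // scaler0.
- by move=> i; rewrite mxE mulr_gt0 // invr_gt0.
- under eq_bigr do rewrite mxE.
  by rewrite -mulr_sumr mulVf // gt_eqF.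
Qed.

(** The set defining [kernel_vector] is nonempty, so [xget] does not return its default 0. *)
Lemma kernel_vectorP (R : realType) (n : nat) (hn : (0 < n)%N)
    (A : 'M[R]_n) (hA : forall i j, 0 <= A i j) (hG : strongly_connected A) :
  let L := laplacian A in let u := kernel_vector L in
  [/\ L *m u = 0, forall v : 'cV[R]_n, L *m v = 0 -> exists c, v = c *: u,
      forall i, 0 < u i 0 & \sum_i u i 0 = 1].
Proof.
move=> L u.
suff : [set u : 'cV[R]_n | [/\ mxker L = range (fun c : R => c *: u),
    forall i, 0 < u i 0 & \sum_i u i 0 = 1]]%classic u.
  move=> [kerE u0 u1]; split => //.
    suff : mxker L u by [].
    by rewrite kerE; exists 1 => //; rewrite scale1r.
  move=> v Lv; have : mxker L v by [].
  by rewrite kerE => -[c _ <-]; exists c.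
apply: xgetPex.
have [v [Lv v0 v1]] := laplacian_ker_pos hn hA hG.
exists v; split => //; apply/seteqP; split => [x Lx | _ [c _ <-]]; last first.
  by rewrite /mxker /= -scalemxAr Lv scaler0.
(* With this coefficient [x - c *: v] is a kernel vector with a zero entry at [i]. *)
pose i := Ordinal hn; exists (x i 0 / v i 0) => //; apply/eqP.
rewrite eq_sym -subr_eq0; apply/eqP.
apply: (@laplacian_ker_eq0 _ _ _ hA hG _ i).
  by rewrite mulmxBr Lx -scalemxAr Lv scaler0 subrr.
by rewrite !mxE divfK ?subrr // gt_eqF.
Qed.

(** * Generalised inverses of a matrix with one-dimensional kernel *)

Lemma mulmx_eq0_factor (F : fieldType) (m n : nat) (M : 'M[F]_n) (u : 'cV[F]_n)
    (N : 'M[F]_(n, m)) :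
  (forall v : 'cV_n, M *m v = 0 -> exists c, v = c *: u) ->
  M *m N = 0 -> exists q, N = u *m q.
Proof.
move=> kerM MN; have : (N^T <= u^T)%MS.
  apply/row_subP => i; rewrite -tr_col.
  have [|c ->] := kerM (col i N); first by rewrite colE mulmxA MN mul0mx.
  by rewrite linearZ scalemx_sub.
case/submxP => q qE; exists q^T.
by rewrite -[LHS]trmxK qE trmx_mul trmxK.
Qed.

(** The left and right kernels of a square matrix have equal dimension, here at most 1, so the
    nonzero [e] spans the left one. *)
Lemma mulmx_eq0_factor_left (F : fieldType) (m n : nat) (M : 'M[F]_n)
    (u : 'cV[F]_n) (e : 'rV[F]_n) (N : 'M[F]_(m, n)) :
  (forall v : 'cV_n, M *m v = 0 -> exists c, v = c *: u) ->
  e != 0 -> e *m M = 0 -> N *m M = 0 -> exists p, N = p *m e.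
Proof.
move=> kerM e0 eM NM; apply/submxP.
have eK : (e <= kermx M)%MS by apply/sub_kermxP.
suff re : (\rank (kermx M) <= \rank e)%N.
  apply: (@submx_trans _ _ _ _ _ _ (kermx M)); first exact/sub_kermxP.
  by rewrite -(geq_leqif (mxrank_leqif_sup eK)).
rewrite rank_rV e0 /= mxrank_ker -mxrank_tr -mxrank_ker.
have [|q qE] := mulmx_eq0_factor (N := (kermx M^T)^T) kerM.
  by rewrite -[LHS]trmxK trmx_mul trmxK mulmx_ker trmx0.
by rewrite -mxrank_tr qE (leq_trans (mxrankM_maxl _ _)) // rank_leq_col.
Qed.

(* The Moore-Penrose, group and absorption inverses of the Laplacian are all of
   this form, with different [p] and [q]. *)
Definition proj_inverse (F : fieldType) (n : nat) (G : 'M[F]_n)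
    (u : 'cV[F]_n) (q : 'rV[F]_n) (p : 'cV[F]_n) (e : 'rV[F]_n) : 'M[F]_n :=
  (1%:M - u *m q) *m G *m (1%:M - p *m e).

(** The defects [1 - M G] and [1 - G M] have the forms [b *m e] and [u *m b]. The outer projectors
    remove them, because [e] annihilates [1 - p e] and [1 - u q] annihilates [u]. *)
Lemma proj_inverseP (F : fieldType) (n : nat) (M G : 'M[F]_n)
    (u p : 'cV[F]_n) (e q : 'rV[F]_n) (Y := proj_inverse G u q p e) :
  (forall v : 'cV_n, M *m v = 0 -> exists c, v = c *: u) ->
  M *m u = 0 -> e *m M = 0 -> M *m G *m M = M ->
  q *m u = 1%:M -> e *m p = 1%:M ->
  [/\ M *m Y = 1%:M - p *m e, Y *m M = 1%:M - u *m q,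
      M *m Y *m M = M, Y *m M *m Y = Y & Y *m p = 0].
Proof.
move=> kerM Mu eM MGM qu ep.
have e0 : e != 0.
  apply/eqP => e0; move: ep; rewrite e0 mul0mx => /eqP.
  by rewrite eq_sym (negPf (matrix_nonzero1 _ _)).
have qq : (1%:M - u *m q) *m u = 0.
  by rewrite mulmxBl mul1mx -mulmxA qu mulmx1 subrr.
have pp : (1%:M - p *m e) *m p = 0.
  by rewrite mulmxBl mul1mx -mulmxA ep mulmx1 subrr.
have ee : e *m (1%:M - p *m e) = 0.
  by rewrite mulmxBr mulmx1 mulmxA ep mul1mx subrr.
have Mq : M *m (1%:M - u *m q) = M.
  by rewrite mulmxBr mulmx1 mulmxA Mu mul0mx subr0.
have pM : (1%:M - p *m e) *m M = M.
  by rewrite mulmxBl mul1mx -mulmxA eM mulmx0 subr0.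
have MY : M *m Y = 1%:M - p *m e.
  have [|b bE] := mulmx_eq0_factor_left (N := 1%:M - M *m G) kerM e0 eM.
    by rewrite mulmxBl mul1mx MGM subrr.
  have -> : M *m Y = M *m G *m (1%:M - p *m e).
    by rewrite /Y /proj_inverse !mulmxA Mq.
  have -> : M *m G = 1%:M - b *m e by rewrite -bE opprB addrC subrK.
  by rewrite [LHS]mulmxBl mul1mx -mulmxA ee mulmx0 subr0.
have YM : Y *m M = 1%:M - u *m q.
  have [|b bE] := mulmx_eq0_factor (N := 1%:M - G *m M) kerM.
    by rewrite mulmxBr mulmx1 mulmxA MGM subrr.
  have -> : Y *m M = (1%:M - u *m q) *m (G *m M).
    by rewrite /Y /proj_inverse -!mulmxA pM.
  have -> : G *m M = 1%:M - u *m b by rewrite -bE opprB addrC subrK.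
  by rewrite [LHS]mulmxBr mulmx1 mulmxA qq mul0mx subr0.
split => //; first by rewrite MY.
- rewrite YM /Y /proj_inverse !mulmxA [X in X *m _ *m _]mulmxBr mulmx1 mulmxA qq.
  by rewrite mul0mx subr0.
- by rewrite /Y /proj_inverse -!mulmxA pp !mulmx0.
Qed.

Lemma scale_inv_mx11 (F : fieldType) (B : 'M[F]_1) :
  B 0 0 != 0 -> (B 0 0)^-1 *: B = 1%:M.
Proof. by move=> B0; rewrite {2}[B]mx11_scalar scale_scalar_mx mulVf. Qed.

(** Taking [q] and [p] proportional to [u^T] and [e^T] makes both projectors symmetric. *)
Lemma moore_penrose_simple_ker (R : realType) (n : nat) (M : 'M[R]_n)
    (u : 'cV[R]_n) (e : 'rV[R]_n) :
  (forall v : 'cV_n, M *m v = 0 -> exists c, v = c *: u) ->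
  M *m u = 0 -> e *m M = 0 ->
  (u^T *m u) 0 0 != 0 -> (e *m e^T) 0 0 != 0 ->
  M *m moore_penrose M *m M = M.
Proof.
move=> kerM Mu eM u0 e0.
suff : [set Y | [/\ M *m Y *m M = M, Y *m M *m Y = Y,
                 (M *m Y)^T = M *m Y & (Y *m M)^T = Y *m M]]%classic
       (moore_penrose M) by case.
apply: xgetPex.
pose q := ((u^T *m u) 0 0)^-1 *: u^T; pose p := ((e *m e^T) 0 0)^-1 *: e^T.
have qu : q *m u = 1%:M by rewrite -scalemxAl scale_inv_mx11.
have ep : e *m p = 1%:M by rewrite -scalemxAr scale_inv_mx11.
(* [pinvmx M] enters only as some {1}-inverse. *)
have [MY YM MYM YMY _] :=
  proj_inverseP kerM Mu eM (mulmxKpV (submx_refl M)) qu ep.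
exists (proj_inverse (pinvmx M) u q p e); split=> //.
- by rewrite MY linearB /= tr_scalar_mx trmx_mul /p linearZ /= trmxK
     -scalemxAr scalemxAl.
- by rewrite YM linearB /= tr_scalar_mx trmx_mul /q linearZ /= trmxK
     -scalemxAr scalemxAl.
Qed.

(** With [p = u] and [q = e] the two projectors coincide, which is the commutation law. *)
Lemma group_inverse_simple_ker (R : realType) (n : nat) (M : 'M[R]_n)
    (u : 'cV[R]_n) (e : 'rV[R]_n) :
  (forall v : 'cV_n, M *m v = 0 -> exists c, v = c *: u) ->
  M *m u = 0 -> e *m M = 0 -> e *m u = 1%:M ->
  M *m group_inverse M *m M = M.
Proof.
move=> kerM Mu eM eu.
suff : [set Y | [/\ M *m Y *m M = M, Y *m M *m Y = Y & M *m Y = Y *m M]]%classic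
       (group_inverse M) by case.
apply: xgetPex.
have [MY YM MYM YMY _] :=
  proj_inverseP kerM Mu eM (mulmxKpV (submx_refl M)) eu eu.
by exists (proj_inverse (pinvmx M) u e u e); split=> //; rewrite MY YM.
Qed.

(** * The absorption inverse *)

(** [N10] is the kernel of [q] and [R10] the line through [p], so the defining conditions on [X]
    become [X L = 1 - u q] and [X p = 0]. *)
Lemma absorption_inverse_proj (R : realType) (n : nat) (L Y : 'M[R]_n)
    (d u : 'cV[R]_n) (c := ((d^T *m u) 0 0)^-1) :
  (forall v : 'cV_n, L *m v = 0 -> exists c, v = c *: u) ->
  L *m u = 0 -> ones^T *m L = 0 -> L *m Y *m L = L -> (d^T *m u) 0 0 != 0 ->
  absorption_inverse L d
  = proj_inverse Y u (c *: d^T) (c *: (diagc d *m u)) ones^T.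
Proof.
move=> kerL Lu eL LYL du0.
set q := c *: d^T; set p := c *: _; set X := proj_inverse _ _ _ _ _.
have qu : q *m u = 1%:M by rewrite -scalemxAl scale_inv_mx11.
have ep : ones^T *m p = 1%:M.
  by rewrite -scalemxAr mulmxA ones_diagc scale_inv_mx11.
have [LX XL LXL XLX Xp] := proj_inverseP kerL Lu eL LYL qu ep.
have N10q y : N10 L d y <-> q *m y = 0.
  split=> [[x _ /= Lx] | qy].
    by rewrite -scalemxAl -ones_diagc -mulmxA -Lx mulmxA eL mul0mx scaler0.
  (* [L X = 1 - p 1^T] fixes vectors of zero sum, and [D y] has sum [d^T y = 0]. *)
  exists (X *m (diagc d *m y)) => //=.
  rewrite mulmxA LX mulmxBl mul1mx -mulmxA [ones^T *m _]mulmxA ones_diagc.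
  move/eqP: qy; rewrite -scalemxAl scalemx_eq0 invr_eq0 (negPf du0) /=.
  by move=> /eqP ->; rewrite mulmx0 subr0.
have R10p (Z : 'M[R]_n) : (forall y, R10 L d y -> Z *m y = 0) <-> Z *m p = 0.
  split=> [H | Zp y [x /kerL[a ->] <-]].
    by rewrite -scalemxAr H ?scaler0 //; exists u.
  move/eqP: Zp; rewrite -!scalemxAr scalemx_eq0 invr_eq0 (negPf du0) /=.
  by move=> /eqP ->; rewrite scaler0.
apply: xget_unique => [|Z [ZL /R10p Zp]].
  split; last exact/R10p.
  by move=> y /N10q qy; rewrite XL mulmxBl mul1mx -mulmxA qy mulmx0 subr0.
(* [Z L] is the identity on each column of [1 - u q], and [L (1 - u q) = L]. *)
have {}ZL : Z *m L = 1%:M - u *m q.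
  have : Z *m L *m (1%:M - u *m q) = 1%:M - u *m q.
    apply/matrixP => i j.
    have /ZL : N10 L d (col j (1%:M - u *m q)).
      by apply/N10q; rewrite colE mulmxA mulmxBr mulmx1 mulmxA qu mul1mx subrr
         mul0mx.
    rewrite {1}colE mulmxA -colE => /colP/(_ i).
    by rewrite [LHS]mxE [RHS]mxE.
  rewrite mulmxBr mulmx1 -[_ *m L *m _]mulmxA.
  by rewrite [L *m _]mulmxA Lu mul0mx mulmx0 subr0.
(* Uniqueness: [X = X L X = Z L X = Z (1 - p 1^T) = Z]. *)
rewrite -[RHS]XLX XL -ZL -[RHS]mulmxA LX.
by rewrite mulmxBr mulmx1 mulmxA Zp mul0mx subr0.
Qed.

(** * The stationary distribution and the fundamental matrix *)

(** A path from [i] to a second vertex begins with an edge leaving [i]. *)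
Lemma outdegree_gt0 (R : realType) (n : nat) (hn : (2 <= n)%N) (A : 'M[R]_n)
    (hA : forall i j, 0 <= A i j) (hG : strongly_connected A) i :
  0 < outdegree A i 0.
Proof.
have w0 : 0 <= outdegree A i 0 by rewrite mxE sumr_ge0.
rewrite lt_def w0 andbT; apply/negP; rewrite mxE psumr_eq0 // => /allP Ai.
have [j ji] : exists j : 'I_n, j != i.
  have : (0 < #|predC1 i|)%N by rewrite cardC1 card_ord -subn1 subn_gt0.
  by case/card_gt0P => j; exists j.
have /connectP[[|k p] /=] := hG i j; first by move=> _ /eqP; rewrite (negPf ji).
move=> /andP[+ _] _; rewrite /edge.
by have /implyP/(_ isT)/eqP -> := Ai k (mem_index_enum k); rewrite ltxx.
Qed.

(** Since [P W = A], the substitution [p = W v] turns [P p = p] into [L v = 0], and the sum of [p]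
    into [w^T v]. *)
Lemma stationaryP (R : realType) (n : nat) (hn : (2 <= n)%N) (A : 'M[R]_n)
    (hA : forall i j, 0 <= A i j) (hG : strongly_connected A) :
  exists v : 'cV[R]_n, laplacian A *m v = 0 /\
    (outdegree A)^T *m v = 1%:M /\ stationary A = diagc (outdegree A) *m v.
Proof.
set w := outdegree A; set L := laplacian A.
have w0 := outdegree_gt0 hn hA hG.
have wU : diagc w \in unitmx.
  rewrite unitmxE det_diag unitfE; apply/prodf_neq0 => i _.
  by rewrite mxE gt_eqF.
have [u [Lu u0 _]] := laplacian_ker_pos (ltnW hn) hA hG.
have transE (v : 'cV_n) :
    transition A *m (diagc w *m v) = diagc w *m v - L *m v.
  by rewrite /transition mulmxA mulmxKV // mulmxBl opprB addrC subrK.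
suff [] : [set p | [/\ transition A *m p = p, \sum_i p i 0 = 1
                    & forall i, 0 < p i 0]]%classic (stationary A).
  move=> Pp p1 _; exists (invmx (diagc w) *m stationary A).
  have sE : diagc w *m (invmx (diagc w) *m stationary A) = stationary A.
    by rewrite mulKVmx.
  split; last split=> //.
  - move: (transE (invmx (diagc w) *m stationary A)); rewrite sE Pp => /eqP.
    by rewrite eq_sym -subr_eq0 addrAC subrr add0r oppr_eq0 => /eqP.
  - by rewrite -ones_diagc -mulmxA sE [LHS]mx11_scalar ones_mulE p1.
apply: xgetPex.
have wu0 := dot_gt0 (ltnW hn) w0 u0.
exists (diagc w *m (((w^T *m u) 0 0)^-1 *: u)); split.
- by rewrite transE -!scalemxAr Lu scaler0 subr0.
- rewrite -ones_mulE mulmxA ones_diagc -scalemxAr scale_inv_mx11 ?gt_eqF //.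
  by rewrite mxE.
- by move=> i; rewrite diagc_mulE [X in _ * X]mxE !mulr_gt0 // ?invr_gt0.
Qed.

(** For a null vector [x], multiplying by [1^T] gives [w^T x = 0], hence [L x = 0]. So [x] is a
    multiple of [v], and [w^T v = 1] forces it to be 0. *)
Lemma fundamental_base_unit (R : realType) (n : nat) (hn : (2 <= n)%N)
    (A : 'M[R]_n) (hA : forall i j, 0 <= A i j) (hG : strongly_connected A) :
  fundamental_base A \in unitmx.
Proof.
have [v [Lv [wv pE]]] := stationaryP hn hA hG.
have [Lu kerL _ _] := kernel_vectorP (ltnW hn) hA hG.
set w := outdegree A in wv pE *; set L := laplacian A in Lv Lu kerL *.
rewrite -unitmx_tr unitmxE unitfE; apply/det0P => -[r r0].
move=> /(congr1 trmx); rewrite trmx_mul trmxK trmx0; set x := r^T => Bx.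
have wx : w^T *m x = 0.
  have := congr1 (mulmx ones^T) Bx.
  rewrite mulmx0 mulmxA /fundamental_base mulmxDr ones_laplacian add0r pE.
  by rewrite !mulmxA ones_diagc wv mul1mx.
move: Bx; rewrite mulmxDl -mulmxA wx mulmx0 addr0 => Lx.
have [a xE] := kerL _ Lx; have [b vE] := kerL _ Lv.
have b0 : b != 0.
  apply/eqP => b0; move: wv; rewrite vE b0 scale0r mulmx0 => /eqP.
  by rewrite eq_sym (negPf (matrix_nonzero1 _ _)).
have xv : x = (a / b) *: v by rewrite vE scalerA divfK.
move: wx; rewrite xv -scalemxAr wv => /matrixP/(_ 0 0).
rewrite !mxE eqxx mulr1 => ab.
by move: r0; rewrite -trmx_eq0 -/x xv ab scale0r eqxx.
Qed.

(** The base matrix sends [v] to the stationary vector, so [Z] sends that vector back to [v], which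
    [L] kills. *)
Lemma fundamental_ginv (R : realType) (n : nat) (hn : (2 <= n)%N)
    (A : 'M[R]_n) (hA : forall i j, 0 <= A i j) (hG : strongly_connected A) :
  laplacian A *m fundamental A *m laplacian A = laplacian A.
Proof.
have [v [Lv [wv pE]]] := stationaryP hn hA hG.
have BU := fundamental_base_unit hn hA hG.
have Zp : fundamental A *m stationary A = v.
  have <- : fundamental_base A *m v = stationary A.
    by rewrite mulmxDl Lv add0r -mulmxA wv mulmx1.
  by rewrite mulKmx.
have LE : laplacian A = fundamental_base A - stationary A *m (outdegree A)^T.
  by rewrite addrK.
rewrite {2}LE mulmxBr mulmxKV // -mulmxA [fundamental A *m _]mulmxA Zp.
by rewrite mulmxA Lv mul0mx subr0.
Qed.

Theorem theorem4 (R : realType) (n : nat) (hn : (2 <= n)%N)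
    (A : 'M[R]_n) (hA : forall i j, 0 <= A i j) (hG : strongly_connected A)
    (d : 'cV[R]_n) (hd : forall i, 0 < d i 0) :
  let L := laplacian A in
  let D := diagc d in
  let U := absorption_U L d in
  let Ld := absorption_inverse L d in
  (forall Y : 'M[R]_n, L *m Y *m L = L ->
     Ld = (1%:M - U *m D) *m Y *m (1%:M - D *m U)) /\
  (let Y := moore_penrose L in
   L *m Y *m L = L /\ Ld = (1%:M - U *m D) *m Y *m (1%:M - D *m U)) /\
  (let Y := group_inverse L in
   L *m Y *m L = L /\ Ld = (1%:M - U *m D) *m Y *m (1%:M - D *m U)) /\
  (fundamental_base A \in unitmx /\
   let Y := fundamental A in
   L *m Y *m L = L /\ Ld = (1%:M - U *m D) *m Y *m (1%:M - D *m U)).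
Proof.
move=> L D U Ld.
have n0 := ltnW hn.
have [Lu kerL u0 u1] := kernel_vectorP n0 hA hG.
have eL := ones_laplacian A.
set u := kernel_vector _ in Lu kerL u0 u1.
have main (Y : 'M[R]_n) : L *m Y *m L = L ->
    Ld = (1%:M - U *m D) *m Y *m (1%:M - D *m U).
  move=> LYL; have du0 := lt0r_neq0 (dot_gt0 n0 hd u0).
  rewrite [LHS](absorption_inverse_proj kerL Lu eL LYL du0) /proj_inverse.
  have -> : U *m D = u *m (((d^T *m u) 0 0)^-1 *: d^T).
    by rewrite -scalemxAl -mulmxA ones_diagc scalemxAr.
  have -> : D *m U = (((d^T *m u) 0 0)^-1 *: (D *m u)) *m ones^T.
    by rewrite -scalemxAr mulmxA scalemxAl.
  by [].
have mp : L *m moore_penrose L *m L = L.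
  apply: (moore_penrose_simple_ker kerL Lu eL); rewrite ?trmxK gt_eqF //.
    exact: dot_gt0.
  by apply: dot_gt0 => // i; rewrite mxE.
have gi : L *m group_inverse L *m L = L.
  by apply: (group_inverse_simple_ker kerL Lu eL);
     rewrite [LHS]mx11_scalar ones_mulE u1.
have fi : L *m fundamental A *m L = L by exact: fundamental_ginv.
by do ![split]; try exact: main; rewrite // fundamental_base_unit.
Qed.
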